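(* Let $0<\alpha\le 1$, let $X,Y$ be Banach spaces and let $u:\mathbb{R}_{\ge 0}\to\mathcal{L}(X;Y)$ be a function. Then the following are equivalent: (a) for each $x\in X$ there is $t_x\ge 0$ such that the orbit $u_x$ is $\alpha$-Hölder continuous on $(t_x,\infty)$; (b) there is $t\ge 0$ such that for all $x\in X$ the orbit $u_x$ is $\alpha$-Hölder continuous on $(t,\infty)$.
   Context: $X,Y$ are Banach spaces over the same field $\mathbb{R}$ or $\mathbb{C}$; $\mathcal{L}(X;Y)$ is the space of bounded linear operators from $X$ to $Y$; $\mathbb{R}_{\ge 0}=[0,\infty)$. No continuity or other regularity of $u$ is assumed. For $x\in X$, the orbit is the function $u_x:\mathbb{R}_{\ge 0}\to Y$, $u_x(t)=u(t)x$. A function $f$ is $\alpha$-Hölder continuous on an interval $J$ if $\sup\{\|f(s)-f(r)\|/(s-r)^\alpha : r,s\in J,\ r<s\}<\infty$. *)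

(* Defs.v *)
From Stdlib Require Import Reals.
From Coquelicot Require Import Coquelicot.
Open Scope R_scope.

(** [is_linear] includes boundedness: it asks for [M] with
    [norm (f x) <= M * norm x] for all [x]. *)
Definition bounded_operator {K : AbsRing} (X Y : NormedModule K) : Type :=
  {f : X -> Y | is_linear f}.

Definition orbit {K : AbsRing} {X Y : NormedModule K}
    (u : nonnegreal -> bounded_operator X Y) (x : X) : nonnegreal -> Y :=
  fun t => proj1_sig (u t) x.

Definition holder_quotients {K : AbsRing} {Y : NormedModule K}
    (alpha : R) (J : R -> Prop) (f : nonnegreal -> Y) : R -> Prop :=
  fun q => exists r s : nonnegreal, J r /\ J s /\ r < s /\
    q = norm (minus (f s) (f r)) / Rpower (s - r) alpha.

Definition holder_on {K : AbsRing} {Y : NormedModule K}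
    (alpha : R) (J : R -> Prop) (f : nonnegreal -> Y) : Prop :=
  Rbar_lt (Lub_Rbar (holder_quotients alpha J f)) p_infty.

Definition open_ray (t : R) : R -> Prop := fun s => t < s.

(* Main.v *)
Require Import Defs.
From Stdlib Require Import Reals Lra Lia Classical ClassicalEpsilon.
From Coquelicot Require Import Coquelicot.
Open Scope R_scope.

(** Hölder continuity of all orbits is a pointwise boundedness property of the
    operators [u s - u r], with weights [(s - r) ^ alpha], over an index set of
    pairs [(r, s)] that is allowed to depend on the vector [x]; (b) asks for a
    single index set.  This is the setting of the uniform boundedness
    principle, and its Baire category proof still works when the index set
    varies through a sequence.

    For each [n] let [A n] be the set of [x] whose orbit has all Hölder
    quotients on [(n, oo)] at most [n].  Each single [u s] is continuous, so
    [A n] is an intersection of closed sets, hence closed, and no regularity of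
    [u] in time is involved.  By (a) the sets [A n] cover [X], because enlarging
    [n] both shortens the ray and relaxes the bound.  By Baire's theorem
    ([baire_closed_cover]) some [A n] contains a ball.  Subtracting its centre
    shows that the quotients on [(n, oo)] are at most [2 n] for all [x] close
    to [0], and homogeneity gives a finite bound on the same ray for every [x]
    ([uniform_index_set]). *)

(** * Baire's theorem *)

(** With centres [x k] and radii [e k], the balls are nested because moving by
    less than half of the old radius and halving the radius stays inside the
    old ball.  The limit is only known to lie in the closure of each ball, so
    it is the ball of doubled radius around [x (k + 1)] that has to avoid [A k].
    The limit is thus outside every [A k]. *)
Lemma baire_closed_cover {T : CompleteSpace} (A : nat -> T -> Prop) (x0 : T) :
  (forall n, closed (A n)) -> (forall x, exists n, A n x) ->
  exists n (x : T) (e : posreal), forall y, ball x e y -> A n y.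
Proof.
intros Hcl Hcov.
apply NNPP; intros Hno.
assert (step : forall (n : nat) (p : T * posreal), exists q : T * posreal,
    ball (fst p) (snd p / 2) (fst q) /\ snd q <= snd p / 2 /\
    forall z, ball (fst q) (2 * snd q) z -> ~ A n z).
{ intros n [x e]; simpl.
  assert (Hy : exists y, ball x (e / 2) y /\ ~ A n y).
  { apply NNPP; intros Hn; apply Hno.
    exists n, x, (pos_div_2 e); intros y Hy.
    apply NNPP; intros HA; apply Hn; now exists y. }
  destruct Hy as [y [Hxy HA]].
  assert (Hloc : locally y (fun z => ~ A n z)).
  { apply NNPP; intros Hl; apply HA; now apply Hcl. }
  destruct Hloc as [d Hd].
  assert (Hr : 0 < Rmin (e / 2) (d / 2)).
  { pose proof (cond_pos e); pose proof (cond_pos d).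
    apply Rmin_glb_lt; lra. }
  exists (y, mkposreal _ Hr); simpl; split; [exact Hxy|split].
  - apply Rmin_l.
  - intros z Hz; apply Hd; apply ball_le with (2 := Hz).
    pose proof (Rmin_r (e / 2) (d / 2)); lra. }
set (next := fun (n : nat) (p : T * posreal) => proj1_sig (constructive_indefinite_description _ (step n p))).
assert (Hnext : forall n (p : T * posreal), ball (fst p) (snd p / 2) (fst (next n p)) /\
    snd (next n p) <= snd p / 2 /\
    forall z, ball (fst (next n p)) (2 * snd (next n p)) z -> ~ A n z).
{ intros n p; exact (proj2_sig (constructive_indefinite_description _ (step n p))). }
clearbody next.
set (s := nat_rect (fun _ => (T * posreal)%type) (x0, mkposreal 1 Rlt_0_1) next).
set (x := fun n => fst (s n)).
set (e := fun n => snd (s n)).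
assert (Hx : forall n, ball (x n) (e n / 2) (x (S n))) by (intros n; apply Hnext).
assert (He : forall n, e (S n) <= e n / 2) by (intros n; apply (Hnext n (s n))).
assert (HA : forall n z, ball (x (S n)) (2 * e (S n)) z -> ~ A n z)
  by (intros n; apply (Hnext n (s n))).
clearbody x e; clear s.
assert (Hsmall : forall n, e n <= e 0%nat * (1 / 2) ^ n).
{ induction n as [|n IH]; simpl; [lra|]; pose proof (He n); lra. }
assert (Hnest : forall k m z, ball (x (k + m)%nat) (e (k + m)%nat) z -> ball (x k) (e k) z).
{ intros k m; induction m as [|m IH]; intros z Hz.
  - now rewrite Nat.add_0_r in Hz.
  - apply IH; rewrite Nat.add_succ_r in Hz.
    apply ball_le with (e (k + m)%nat / 2 + e (S (k + m))).
    + pose proof (He (k + m)%nat); lra.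
    + eapply ball_triangle; [apply Hx|exact Hz]. }
assert (Htail : forall k m, (k <= m)%nat -> ball (x k) (e k) (x m)).
{ intros k m Hkm; apply (Hnest k (m - k)%nat).
  replace (k + (m - k))%nat with m by lia; apply ball_center. }
set (F := filtermap x eventually).
assert (FF : ProperFilter F)
  by (apply filtermap_proper_filter; apply eventually_filter).
assert (HF : cauchy F).
{ intros eps.
  assert (Hq : 0 < eps / e 0%nat) by (apply Rdiv_lt_0_compat; apply cond_pos).
  destruct (pow_lt_1_zero (1 / 2) ltac:(rewrite Rabs_pos_eq; lra) _ Hq) as [N HN].
  exists (x N), N; intros m Hm.
  apply ball_le with (e N); [|now apply Htail].
  specialize (HN N (le_n N)).
  rewrite Rabs_pos_eq in HN by (apply pow_le; lra).
  apply (Rmult_lt_compat_l (e 0%nat)) in HN; [|apply cond_pos].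
  replace (e 0%nat * (eps / e 0%nat)) with (pos eps) in HN
    by (field; apply Rgt_not_eq, cond_pos).
  specialize (Hsmall N); lra. }
destruct (Hcov (lim F)) as [n Hn].
apply (HA n (lim F)); [|exact Hn].
destruct (complete_cauchy F FF HF (e (S n))) as [N HN].
replace (2 * e (S n)) with (e (S n) + e (S n)) by ring.
apply ball_triangle with (x (Nat.max N (S n))).
- apply Htail; lia.
- apply ball_sym, HN; lia.
Qed.

(** * Uniform boundedness with a varying index set *)

(** Homogeneity arguments need to shrink a vector by an invertible scalar; an
    absolute ring in general, such as the integers, has no such scalars. *)
Definition has_small_units (K : AbsRing) : Prop :=
  forall eps, 0 < eps -> exists a b : K, mult b a = one /\ abs a < eps.

Lemma has_small_units_R : has_small_units R_AbsRing.
Proof.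
intros eps Heps; exists (eps / 2), (/ (eps / 2)); split.
- apply Rinv_l; lra.
- unfold abs; simpl; rewrite Rabs_pos_eq; lra.
Qed.

Lemma has_small_units_C : has_small_units C_AbsRing.
Proof.
intros eps Heps; exists (RtoC (eps / 2)), (Cinv (RtoC (eps / 2))); split.
- apply Cinv_l; intros H; apply RtoC_inj in H; lra.
- unfold abs; simpl; rewrite Cmod_R, Rabs_pos_eq; lra.
Qed.

Lemma minus_plus_r {G : AbelianGroup} (x y : G) : minus (plus x y) y = x.
Proof.
unfold minus; rewrite <- plus_assoc.
exact (eq_trans (f_equal (plus x) (plus_opp_r y)) (plus_zero_r x)).
Qed.

Lemma is_linear_minus_fun {K : AbsRing} {U V : NormedModule K} (f g : U -> V) :
  is_linear f -> is_linear g -> is_linear (fun x => minus (f x) (g x)).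
Proof.
intros Hf Hg.
apply (is_linear_comp (fun x => (f x, opp (g x))) (fun p => plus (fst p) (snd p)));
  [|apply is_linear_plus].
apply (is_linear_prod f (fun x => opp (g x)) Hf).
apply is_linear_comp; [exact Hg|apply is_linear_opp].
Qed.

Lemma closed_forall {T : UniformSpace} {I : Type} (D : I -> T -> Prop) :
  (forall i, closed (D i)) -> closed (fun x => forall i, D i x).
Proof.
intros HD x Hx i; apply HD; intros Hloc; apply Hx.
revert Hloc; apply filter_imp; intros y Hy HDy; now apply Hy.
Qed.

Lemma closed_norm_linear_le {K : AbsRing} {U V : NormedModule K} (f : U -> V) (c : R) :
  is_linear f -> closed (fun x => norm (f x) <= c).
Proof.
intros Hf.
apply (closed_comp (fun x => norm (f x)) (fun y => y <= c)); [|apply closed_le].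
intros x; eapply filterlim_comp; [apply (linear_cont f x Hf)|apply filterlim_norm].
Qed.

(** The sets [J n] need not be comparable: Baire's theorem selects one of them,
    and a ball of vectors satisfying the bound over that [J n] spreads to all
    of [X] by translation and scaling.  For constant [J] this is the
    Banach-Steinhaus argument.  A natural number serves both as the index of
    the set and as the bound, which makes the cover countable. *)
Lemma uniform_index_set {K : AbsRing} (hK : has_small_units K)
    (X : CompleteNormedModule K) (Y : NormedModule K) {I : Type}
    (T : I -> X -> Y) (w : I -> R) (J : nat -> I -> Prop) :
  (forall i, is_linear (T i)) ->
  (forall x, exists n, forall i, J n i -> norm (T i x) <= INR n * w i) ->
  exists n, forall x, exists M, forall i, J n i -> norm (T i x) <= M * w i.
Proof.
intros HT Hcov.
destruct (@baire_closed_cover X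
  (fun n x => forall i, J n i -> norm (T i x) <= INR n * w i) zero) as [n [x0 [e He]]].
- intros n; apply closed_forall; intros i; apply closed_forall; intros _.
  apply (@closed_norm_linear_le K X Y), HT.
- exact Hcov.
- exists n; intros x.
  (* The summand 1 keeps the denominator positive when [x] is zero. *)
  assert (Hpos : 0 < e / (norm x + 1)).
  { apply Rdiv_lt_0_compat; [apply cond_pos|].
    pose proof (norm_ge_0 x); lra. }
  destruct (hK _ Hpos) as [a [b [Hba Ha]]].
  assert (Hax : norm (scal a x) < e).
  { apply Rle_lt_trans with (1 := norm_scal a x).
    pose proof (norm_ge_0 x) as Hx.
    apply Rle_lt_trans with (abs a * (norm x + 1)).
    - apply Rmult_le_compat_l; [apply abs_ge_0|lra].
    - apply (Rmult_lt_compat_r (norm x + 1)) in Ha; [|lra].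
      replace (e / (norm x + 1) * (norm x + 1)) with (pos e) in Ha by (field; lra).
      exact Ha. }
  exists (abs b * (2 * INR n)); intros i Hi.
  assert (Hball : ball x0 e (plus (scal a x) x0)).
  { apply (@norm_compat1 K X).
    eapply Rle_lt_trans; [|exact Hax].
    right; apply f_equal, (@minus_plus_r X). }
  pose proof (He _ Hball i Hi) as H1.
  pose proof (He _ (ball_center x0 e) i Hi) as H2.
  assert (Hsplit : T i (scal a x) = minus (T i (plus (scal a x) x0)) (T i x0)).
  { rewrite (linear_plus _ (HT i)); symmetry; apply (@minus_plus_r Y). }
  assert (H3 : norm (T i (scal a x)) <= 2 * INR n * w i).
  { rewrite Hsplit; unfold minus.
    eapply Rle_trans; [apply norm_triangle|rewrite norm_opp; lra]. }
  replace (T i x) with (scal b (T i (scal a x))).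
  + eapply Rle_trans; [apply norm_scal|].
    rewrite Rmult_assoc; apply Rmult_le_compat_l; [apply abs_ge_0|exact H3].
  + rewrite (linear_scal _ (HT i)), scal_assoc, Hba; apply scal_one.
Qed.

(** * Hölder continuity of orbits *)

(** In this form the condition is a family of norm bounds, one for each pair
    [(r, s)], as the uniform boundedness argument requires. *)
Lemma holder_on_iff_bounded {K : AbsRing} {Y : NormedModule K}
    (alpha : R) (J : R -> Prop) (f : nonnegreal -> Y) :
  holder_on alpha J f <->
  exists M, forall r s : nonnegreal, J r -> J s -> r < s ->
    norm (minus (f s) (f r)) <= M * Rpower (s - r) alpha.
Proof.
unfold holder_on.
destruct (Lub_Rbar_correct (holder_quotients alpha J f)) as [Hub Hleast].
split.
- intros Hlt.
  assert (HM : exists M : R, Rbar_le (Lub_Rbar (holder_quotients alpha J f)) M).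
  { destruct (Lub_Rbar (holder_quotients alpha J f)) as [l| |]; simpl in Hlt.
    - exists l; apply Rbar_le_refl.
    - contradiction.
    - (* The supremum is minus infinity when [J] has no two points. *)
      now exists 0. }
  destruct HM as [M HM]; exists M; intros r s Hr Hs Hrs.
  apply Rle_div_l; [apply exp_pos|].
  change (Rbar_le (norm (minus (f s) (f r)) / Rpower (s - r) alpha) M).
  eapply Rbar_le_trans; [apply Hub|exact HM].
  now exists r, s.
- intros [M HM].
  apply Rbar_le_lt_trans with M; [|exact Logic.I].
  apply Hleast; intros q [r [s [Hr [Hs [Hrs ->]]]]].
  apply Rle_div_l; [apply exp_pos|now apply HM].
Qed.

Theorem proposition3p4 (K : AbsRing) (hK : K = R_AbsRing \/ K = C_AbsRing)
    (X Y : CompleteNormedModule K) (alpha : R) (halpha : 0 < alpha <= 1)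
    (u : nonnegreal -> bounded_operator X Y) :
  (forall x : X, exists t : nonnegreal, holder_on alpha (open_ray t) (orbit u x)) <->
  (exists t : nonnegreal, forall x : X, holder_on alpha (open_ray t) (orbit u x)).
Proof.
assert (Hunits : has_small_units K)
  by (destruct hK as [-> | ->]; [apply has_small_units_R|apply has_small_units_C]).
split; [|intros [t Ht] x; now exists t].
intros Ha.
destruct (uniform_index_set Hunits X Y
  (fun (p : nonnegreal * nonnegreal) x => minus (orbit u x (snd p)) (orbit u x (fst p)))
  (fun p => Rpower (snd p - fst p) alpha)
  (fun n p => INR n < fst p /\ INR n < snd p /\ fst p < snd p)) as [n Hn].
- intros [r s]; simpl.
  apply (@is_linear_minus_fun K X Y);
    [exact (proj2_sig (u s))|exact (proj2_sig (u r))].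
- intros x; destruct (Ha x) as [t Ht].
  apply holder_on_iff_bounded in Ht; destruct Ht as [M HM].
  destruct (INR_unbounded (Rmax t M)) as [n Hn].
  pose proof (Rmax_l t M); pose proof (Rmax_r t M).
  exists n; intros [r s]; simpl; intros [Hr [Hs Hrs]].
  apply Rle_trans with (M * Rpower (s - r) alpha).
  + apply HM; unfold open_ray; lra.
  + apply Rmult_le_compat_r; [left; apply exp_pos|lra].
- exists (mknonnegreal (INR n) (pos_INR n)); intros x.
  apply holder_on_iff_bounded.
  destruct (Hn x) as [M HM]; exists M; intros r s Hr Hs Hrs.
  apply (HM (r, s)); auto.
Qed.
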